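(* If $G$ is a permutation game, then $G^{\star\star}$ is a permutation game. Furthermore, if $G$ is an involution game, then $G^{\star\star}$ is an involution game.
   Context: $\mathbb{N}=\{1,2,3,\dots\}$, $\mathbb{N}_0=\{0,1,2,\dots\}$. An invariant subtraction game $G$ on $\mathbb{N}_0\times\mathbb{N}_0$ is given by a set of moves $\mathcal{M}(G)\subseteq(\mathbb{N}_0\times\mathbb{N}_0)\setminus\{(0,0)\}$; from position $(x,y)$ the options are all $(x-i,y-j)$ with $(i,j)\in\mathcal{M}(G)$, $i\le x$, $j\le y$. Two players alternate and a player who cannot move loses. A position is $P$ if all its options are $N$ (in particular if it has no options) and is $N$ if it has at least one $P$ option; $\mathcal{P}(G)$ is the set of $P$-positions. The game $G^\star$ is defined by $\mathcal{M}(G^\star)=\mathcal{P}(G)\setminus\{(0,0)\}$, and $G^{\star\star}=(G^\star)^\star$. A permutation game is an invariant subtraction game such that each row and each column of $\mathbb{N}\times\mathbb{N}$ contains precisely one move, and there is no move in row $0$ or column $0$ (no move has a zero coordinate). An involution game is a permutation game whose set of moves is symmetric, i.e. $(x,y)\in\mathcal{M}(G)$ if and only if $(y,x)\in\mathcal{M}(G)$. *)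

(* Defs.v *)
From mathcomp Require Import all_boot.
From mathcomp Require Import classical_sets.

Set Implicit Arguments.
Unset Strict Implicit.
Unset Printing Implicit Defensive.

Local Open Scope classical_set_scope.

Definition position : Type := (nat * nat)%type.

Record game : Type := Game {
  moves : set position;
  moves_neq0 : ~ moves (0, 0)
}.

(* The side conditions i <= x and j <= y make the truncated subtractions
   exact. *)
Definition options (G : game) (p : position) : set position :=
  [set q | exists i j : nat,
     [/\ moves G (i, j), i <= p.1, j <= p.2 & q = (p.1 - i, p.2 - j)] ].

(* Every move strictly decreases x + y, so the least fixed point below is the
   usual recursive classification of the positions. *)
Inductive P_position (G : game) : position -> Prop :=
| P_intro p : (forall q, options G p q -> N_position G q) -> P_position G p
with N_position (G : game) : position -> Prop :=
| N_intro p q : options G p q -> P_position G q -> N_position G p.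

Definition P_positions (G : game) : set position := [set p | P_position G p].

Lemma star_neq0 (G : game) : ~ (P_positions G `\ (0, 0)) (0, 0).
Proof. by case=> _; apply. Qed.

Definition star (G : game) : game := Game (@star_neq0 G).

Definition permutation_game (G : game) : Prop :=
  [/\ forall x, 0 < x -> exists! y, 0 < y /\ moves G (x, y),
      forall y, 0 < y -> exists! x, 0 < x /\ moves G (x, y)
    & forall x y, moves G (x, y) -> 0 < x /\ 0 < y].

Definition involution_game (G : game) : Prop :=
  permutation_game G /\ forall x y, moves G (x, y) <-> moves G (y, x).

(* Main.v *)
Require Import Defs.
From mathcomp Require Import all_boot.
From mathcomp Require Import classical_sets.
From mathcomp Require Import boolp zify.

Set Implicit Arguments.
Unset Strict Implicit.
Unset Printing Implicit Defensive.

(** Let [G] be a permutation game.  No move of [G] starts from a position on a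
    coordinate axis, so these positions are all P-positions of [G].  Hence the
    moves of [star G] include all moves along a single coordinate (those of a
    rook, as in Nim), and each row or column contains at most one P-position of
    [star G] ([P_star_row_uniq]).

    Each row [x] also contains at least one ([P_star_row_exists]).  For every
    [d > 0] there is a move [(d, j)] of [G]; from [(d, z)] with [z >= j] it
    leads to [(0, z - j)], a P-position of [G].  So row [d > 0] of [G] has only
    finitely many P-positions, that is, [star G] has only finitely many moves
    with first coordinate [d] ([P_row_bounded]).  If row [x] contained no
    P-position of [star G], then every [(x, y)] would have an option among the
    P-positions of [star G] in the rows below [x]; there are at most [x] of
    these, and for [y] large enough none of them can be reached.

    The statement about columns is the statement about rows of the transposed
    game.  Since [(0, 0)] is a P-position of [star G], the P-positions of
    [star G] form the graph of a permutation of the naturals that fixes [0];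
    removing [(0, 0)] gives the moves of [star (star G)].  If [G] is its own
    transpose, so are [star G] and [star (star G)]. *)

(** * P-positions of an invariant subtraction game *)

Lemma option_lt (G : game) (p q : position) :
  options G p q -> q.1 + q.2 < p.1 + p.2.
Proof.
move=> [i [j [Mij ip jp ->]]] /=.
have : ~ (i = 0 /\ j = 0).
  by move=> [i0 j0]; apply: (@moves_neq0 G); rewrite -{1}i0 -j0.
lia.
Qed.

Lemma P_N_exclusive (G : game) (p : position) :
  P_position G p -> N_position G p -> False.
Proof.
have [n] := ubnP (p.1 + p.2); elim: n p => // n IHn p ltpn Pp Np.
case: Np Pp ltpn => {}p q pq Pq Pp ltpn.
have Nq : N_position G q by case: Pp pq {ltpn} => {}p; apply.
apply: (IHn q) => //; have := option_lt pq; lia.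
Qed.

Lemma P_or_N (G : game) (p : position) : P_position G p \/ N_position G p.
Proof.
have [n] := ubnP (p.1 + p.2); elim: n p => // n IHn p ltpn.
have [[q [pq Pq]]|noP] := EM (exists q, options G p q /\ P_position G q).
  by right; apply: N_intro pq Pq.
left; constructor=> q pq.
have [||//] := IHn q; first by have := option_lt pq; lia.
by move=> Pq; case: noP; exists q.
Qed.

Lemma P_positionE (G : game) (p : position) :
  P_position G p <-> forall q, options G p q -> ~ P_position G q.
Proof.
split=> [[{}p Np] q pq Pq | noP].
  exact: P_N_exclusive Pq (Np _ pq).
by constructor=> q pq; have [/(noP _ pq)|] := P_or_N G q.
Qed.

Lemma P_position00 (G : game) : P_position G (0, 0).
Proof. by apply/P_positionE => q /option_lt. Qed.

(** * Transposition *)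

(** The moves of [H] are those of [G] with their coordinates exchanged.  As a
    relation between games, rather than an equality with [transpose G], this is
    inherited by duals, and [transposed G G] says that [G] is symmetric. *)
Definition transposed (G H : game) : Prop :=
  forall x y, moves G (x, y) <-> moves H (y, x).

Lemma transposed_sym {G H : game} : transposed G H -> transposed H G.
Proof. by move=> GH x y; split=> /GH. Qed.

(** The game with the moves of [G] reflected in the diagonal. *)
Definition transpose (G : game) : game :=
  @Game (fun p => moves G (p.2, p.1)) (@moves_neq0 G).

Lemma transposeP (G : game) : transposed G (transpose G).
Proof. by []. Qed.

Lemma P_position_transposed (G H : game) (x y : nat) :
  transposed G H -> P_position G (x, y) -> P_position H (y, x).
Proof.
have [n] := ubnP (x + y); elim: n x y G H => // n IHn x y G H lt_n GH PG.
apply/P_positionE => q yxq PH.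
have ltq := option_lt yxq.
case: yxq => i [j [/(transposed_sym GH) Mji iy jx Dq]].
move: ltq PH; rewrite {q}Dq /= in iy jx * => ltq PH.
have xyq : options G (x, y) (x - j, y - i) by exists j, i.
have /P_positionE/(_ _ xyq) := PG; apply.
apply: IHn (transposed_sym GH) PH; lia.
Qed.

Lemma transposed_star {G H : game} :
  transposed G H -> transposed (star G) (star H).
Proof.
move=> GH x y; split=> -[Pxy nz].
  split; first exact: P_position_transposed Pxy.
  by move=> [y0 x0]; case: nz; rewrite y0 x0.
split; first exact: P_position_transposed (transposed_sym GH) Pxy.
by move=> [x0 y0]; case: nz; rewrite y0 x0.
Qed.

Lemma permutation_game_transpose (G : game) :
  permutation_game G -> permutation_game (transpose G).
Proof. by case=> row col pos; split=> // x y /pos []. Qed.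

(** * P-positions of the dual of a permutation game *)

Lemma P_row0 (G : game) (z : nat) : permutation_game G -> P_position G (0, z).
Proof.
case=> _ _ pos; apply/P_positionE => q [i [j [/pos [i_gt0 _] /= i_le0 _ _]]].
lia.
Qed.

(** In each of the rows [1, ..., x], the P-positions of [G] have bounded second
    coordinates; row [0], excluded here, consists of P-positions. *)
Lemma P_row_bounded (G : game) (x : nat) :
  permutation_game G ->
  exists B, forall d z, 0 < d <= x -> B <= z -> ~ P_position G (d, z).
Proof.
move=> permG; elim: x => [|x [B IHx]]; first by exists 0 => d z; lia.
have [row _ _] := permG.
have [j [[_ Mj] _]] := row x.+1 isT.
exists (B + j) => d z d_le Bz.
have [->|neq_dx] := eqVneq d x.+1; last by apply: IHx; lia.
move=> /P_positionE/(_ (0, z - j)); apply; last exact: P_row0.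
by exists x.+1, j; split; rewrite /= ?subnn //; lia.
Qed.

Lemma P_star_row_uniq (G : game) (x y y' : nat) :
  permutation_game G ->
  P_position (star G) (x, y) -> P_position (star G) (x, y') -> y = y'.
Proof.
move=> permG.
wlog lt_yy' : y y' / y < y' => [IH Py Py'|Py].
  have [lt|lt|//] := ltngtP y y'; first exact: IH.
  by apply/esym/IH.
move=> /P_positionE/(_ (x, y)); case=> //.
exists 0, (y' - y); split; rewrite /= ?subn0 ?leq_subr //.
  by split; [exact: P_row0 | case; lia].
by rewrite subKn // ltnW.
Qed.

Lemma P_star_rows_bounded (G : game) (x : nat) :
  permutation_game G ->
  exists C, forall x' y, x' < x -> P_position (star G) (x', y) -> y <= C.
Proof.
move=> permG; elim: x => [|x [C IHx]]; first by exists 0.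
have [[y0 Py0]|noP] := EM (exists y, P_position (star G) (x, y)); last first.
  exists C => x' y lt Pxy; apply: (IHx x') => //.
  have [eq_x|] := eqVneq x' x; last by lia.
  by case: noP; exists y; rewrite -eq_x.
exists (C + y0) => x' y lt Pxy.
have [eq_x|neq_x] := eqVneq x' x.
  rewrite eq_x in Pxy; rewrite (P_star_row_uniq permG Pxy Py0); lia.
have : y <= C by apply: (IHx x') => //; lia.
lia.
Qed.

Lemma P_star_row_exists (G : game) (x : nat) :
  permutation_game G -> exists y, P_position (star G) (x, y).
Proof.
move=> permG; apply: contrapT => noP.
have [B boundB] := P_row_bounded x permG.
have [C boundC] := P_star_rows_bounded x permG.
have Nq q : options (star G) (x, B + C) q -> ~ P_position (star G) q.
  move=> [i [j [[Pij _] /= i_le j_le ->]]] Pq.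
  have [i0|i_gt0] := posnP i.
    by apply: noP; exists (B + C - j); rewrite i0 subn0 in Pq.
  (* The option lies in a lower row, hence in a column at most [C]; so the
     move leading to it has second coordinate at least [B]. *)
  have col_le : B + C - j <= C by apply: boundC Pq; lia.
  by apply: (boundB i j) Pij; lia.
by apply: noP; exists (B + C); apply/P_positionE.
Qed.

(** * The double dual *)

Lemma star_star_row (G : game) (x : nat) :
  permutation_game G -> 0 < x ->
  exists! y, 0 < y /\ moves (star (star G)) (x, y).
Proof.
move=> permG x_gt0.
have [y Py] := P_star_row_exists x permG.
exists y; split; last first.
  by move=> y' [_ [Py' _]]; apply: P_star_row_uniq Py Py'.
split; last by split=> // -[x0]; rewrite x0 in x_gt0.
rewrite lt0n; apply/eqP => y0; rewrite y0 in Py.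
(* Otherwise column [0] would contain the two P-positions [(0, 0)] and
   [(x, 0)] of [star G]. *)
have P0x := P_position_transposed (transposed_star (transposeP G)) Py.
have := P_star_row_uniq (permutation_game_transpose permG) P0x (P_position00 _).
lia.
Qed.

Lemma star_star_move_gt0 (G : game) (x y : nat) :
  permutation_game G -> moves (star (star G)) (x, y) -> 0 < y -> 0 < x.
Proof.
move=> permG [Pxy _] y_gt0; rewrite lt0n; apply/eqP => x0; rewrite x0 in Pxy.
have := P_star_row_uniq permG Pxy (P_position00 _); lia.
Qed.

Lemma permutation_game_star_star (G : game) :
  permutation_game G -> permutation_game (star (star G)).
Proof.
move=> permG.
have permT := permutation_game_transpose permG.
have tr := transposed_star (transposed_star (transposeP G)).
split=> [x||x y Mxy]; first exact: star_star_row.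
  move=> y y_gt0.
  have [x [[x_gt0 Myx] uniq_x]] := star_star_row permT y_gt0.
  exists x; split; first by split=> //; apply/tr.
  by move=> x' [x'_gt0 /tr Myx']; apply: uniq_x.
have Myx : moves (star (star (transpose G))) (y, x) by apply/tr.
have gt0x := star_star_move_gt0 permG Mxy.
have gt0y := star_star_move_gt0 permT Myx.
have [x0|x_gt0] := posnP x; last by split=> //; exact: gt0y.
have [y0|y_gt0] := posnP y; last by have := gt0x y_gt0; lia.
by case: Mxy => _ []; rewrite x0 y0.
Qed.

Theorem theorem3 (G : game) :
  (permutation_game G -> permutation_game (star (star G))) /\
  (involution_game G -> involution_game (star (star G))).
Proof.
split=> [|[permG symG]]; first exact: permutation_game_star_star.
split; first exact: permutation_game_star_star.
exact: transposed_star (transposed_star symG).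
Qed.
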